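(* Suppose $q^{2k}\neq 1$. Consider the set $\mathcal{B}'$ of monomials \[ \prod_{a=1}^n \psi_a^{p_a}(\psi_a^* )^{d_a}\omega_a^{v_a}\qquad(\text{factors in the order } a=1,\dots,n), \] with $p_a,d_a\in\{0,1\}$ and $v_a\in\{0,1,\dots,4k-1\}$, satisfying for every $a$: (1) $p_a+d_a<2$, and (2) $v_a\le 2k-1$ if $p_a+d_a=1$. Then $\mathcal{B}'$ is a $\mathbb{k}$-basis of $\mathrm{Cl}_q(n,k)$.
   Context: Let $\mathbb{k}$ be a field of characteristic different from $2$, let $q\in\mathbb{k}^\times$, and let $n,k$ be positive integers. The quantum Clifford algebra $\mathrm{Cl}_q(n,k)$ is the unital associative $\mathbb{k}$-algebra generated by $\psi_a,\psi_a^*,\omega_a,\omega_a^{-1}$ for $a\in\{1,\dots,n\}$, subject to the relations (for all $a,b\in\{1,\dots,n\}$): $\omega_a\omega_b=\omega_b\omega_a$; $\omega_a\omega_a^{-1}=1$; $\omega_a\psi_b=q^{\delta_{ab}}\psi_b\omega_a$; $\omega_a\psi_b^*=q^{-\delta_{ab}}\psi_b^*\omega_a$; $\psi_a\psi_b+\psi_b\psi_a=0$; $\psi_a^*\psi_b^*+\psi_b^*\psi_a^*=0$; $\psi_a\psi_a^*+q^k\psi_a^*\psi_a=\omega_a^{-k}$; $\psi_a\psi_a^*+q^{-k}\psi_a^*\psi_a=\omega_a^{k}$; and $\psi_a\psi_b^*+\psi_b^*\psi_a=0$ if $a\neq b$. *)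

(* Defs.v *)
From HB Require Import structures.
From mathcomp Require Import all_boot all_order all_algebra.
Set Implicit Arguments. Unset Strict Implicit. Unset Printing Implicit Defensive.
Import Order.TTheory GRing.Theory Num.Theory.
Local Open Scope ring_scope.

Inductive gkind := Psi | PsiS | Om | OmInv.

Definition gkind_code (g : gkind) : 'I_4 :=
  match g with Psi => inord 0 | PsiS => inord 1 | Om => inord 2 | OmInv => inord 3 end.
Definition gkind_decode (i : 'I_4) : gkind :=
  match val i with 0 => Psi | 1 => PsiS | 2 => Om | _ => OmInv end.
Lemma gkind_codeK : cancel gkind_code gkind_decode.
Proof. by case; rewrite /gkind_decode /= inordK. Qed.
HB.instance Definition _ := Equality.copy gkind (can_type gkind_codeK).

(* words in the generators = monomials of the free algebra *)
Definition word (n : nat) := seq (gkind * 'I_n).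
(* formal linear combinations of words = elements of the free algebra
   (two combinations denote the same element iff they have the same
   coefficient function [coef]) *)
Definition poly (F : Type) (n : nat) := seq (F * word n).

Section FreeAlg.
Variables (F : fieldType) (n : nat).

Definition coef (p : poly F n) (x : word n) : F := \sum_(cm <- p | cm.2 == x) cm.1.

Definition sandwich (c : F) (u : word n) (r : poly F n) (w : word n) : poly F n :=
  [seq (c * cm.1, u ++ cm.2 ++ w) | cm <- r].

Definition gw (g : gkind) (a : 'I_n) : word n := [:: (g, a)].
Definition one_w : word n := [::].
Definition ww (x y : word n) : word n := x ++ y.

Variables (q : F) (k : nat).

Definition qpow (e : bool) : F := if e then q else 1.
Definition qinvpow (e : bool) : F := if e then q^-1 else 1.

(* the defining relations, each written as an element r with relation r = 0 *)
Definition is_rel (r : poly F n) : Prop :=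
  exists a b : 'I_n,
     r = [:: (1, ww (gw Om a) (gw Om b)); (-1, ww (gw Om b) (gw Om a))] \/
      r = [:: (1, ww (gw Om a) (gw OmInv a)); (-1, one_w)] \/
      r = [:: (1, ww (gw OmInv a) (gw Om a)); (-1, one_w)] \/
      r = [:: (1, ww (gw Om a) (gw Psi b)); (- qpow (a == b), ww (gw Psi b) (gw Om a))] \/
      r = [:: (1, ww (gw Om a) (gw PsiS b)); (- qinvpow (a == b), ww (gw PsiS b) (gw Om a))] \/
      r = [:: (1, ww (gw Psi a) (gw Psi b)); (1, ww (gw Psi b) (gw Psi a))] \/
      r = [:: (1, ww (gw PsiS a) (gw PsiS b)); (1, ww (gw PsiS b) (gw PsiS a))] \/
      r = [:: (1, ww (gw Psi a) (gw PsiS a)); (q ^+ k, ww (gw PsiS a) (gw Psi a));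
              (-1, nseq k (OmInv, a))] \/
      r = [:: (1, ww (gw Psi a) (gw PsiS a)); ((q ^+ k)^-1, ww (gw PsiS a) (gw Psi a));
              (-1, nseq k (Om, a))] \/
      (a != b /\ r = [:: (1, ww (gw Psi a) (gw PsiS b)); (1, ww (gw PsiS b) (gw Psi a))]).

(* elements of the two-sided ideal generated by the relations, as
   finite sums of c * u * r * w *)
Inductive in_ideal : poly F n -> Prop :=
| in_ideal_nil : in_ideal [::]
| in_ideal_cons (c : F) (u : word n) (r : poly F n) (w : word n) (p : poly F n) :
    is_rel r -> in_ideal p -> in_ideal (sandwich c u r w ++ p).

(* equality in Cl_q(n,k) = free algebra / ideal *)
Definition cl_eq (p p' : poly F n) : Prop :=
  exists i, in_ideal i /\ forall x, coef p x - coef p' x = coef i x.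

(* index data (p_a, d_a, v_a) for a in 1..n *)
Definition bidx := {ffun 'I_n -> bool * bool * 'I_(4 * k)}.

Definition admissible (t : bidx) : bool :=
  [forall a, (((t a).1.1 : nat) + (t a).1.2 < 2)%N &&
     ((((t a).1.1 : nat) + (t a).1.2 == 1)%N ==> ((t a).2 <= 2 * k - 1)%N)].

Definition bmono (t : bidx) : word n :=
  flatten [seq nseq (t a).1.1 (Psi, a) ++ nseq (t a).1.2 (PsiS, a)
               ++ nseq (t a).2 (Om, a) | a <- enum 'I_n].

Definition bcomb (c : bidx -> F) : poly F n :=
  [seq (c t, bmono t) | t <- enum bidx & admissible t].

Definition is_basis_B' : Prop :=
  (forall p : poly F n, exists c : bidx -> F, cl_eq p (bcomb c)) /\
  (forall c : bidx -> F, cl_eq (bcomb c) [::] -> forall t, admissible t -> c t = 0).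

End FreeAlg.

(* Main.v *)
(** Linear independence: on functions of [(s, i)], with [s] a bit and [i] an integer
    modulo [2k], let [omega] shift [i] by one and multiply by [q^-s], let [psi] move
    [s] from [0] to [1], and let [psi^*] move it back while shifting [i] by [k].  This
    represents the algebra for [n = 1]; a twisted [n]-th tensor power, in which the odd
    generators of index [a] act by [(-1)^s] on every factor of index larger than [a],
    represents it in general.  On the two values of [s] the powers [omega^v] and
    [omega^(v+2k)] act by scalars whose ratios [1] and [q^(-2k)] differ, so matrix
    coefficients separate the monomials.

    Spanning: as [psi^2 = 0], multiplying the two relations between [psi], [psi^*] and
    [omega] by [psi] or [psi^*] gives [psi omega^2k = q^(-2k) psi] and
    [psi^* omega^2k = psi^*], while eliminating [psi^* psi] expresses [psi psi^*] as a
    combination of [omega^k] and [omega^-k] with nonzero coefficients.  Hence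
    [omega^4k] lies in the span of [omega^2k] and [1], and [omega^-1] in that of
    positive powers of [omega].  Only the shape of these identities and the
    nonvanishing of some coefficients are needed. *)
Require Import Defs.
From mathcomp Require Import all_boot all_order all_algebra.
From mathcomp Require Import zify ring.
Set Implicit Arguments. Unset Strict Implicit. Unset Printing Implicit Defensive.
Import GRing.Theory.
Local Open Scope ring_scope.

(** * Linear functionals on formal combinations of words *)

Section LinearExtension.
Variables (F : fieldType) (n : nat).
Implicit Types (p r : Defs.poly F n) (u v w : word n) (G : word n -> F).

Definition lin G p : F := \sum_(cm <- p) cm.1 * G cm.2.

Lemma lin_nil G : lin G [::] = 0.
Proof. by rewrite /lin big_nil. Qed.

Lemma lin_cons G (cm : F * word n) p : lin G (cm :: p) = cm.1 * G cm.2 + lin G p.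
Proof. by rewrite /lin big_cons. Qed.

Lemma lin_cat G p r : lin G (p ++ r) = lin G p + lin G r.
Proof. by rewrite /lin big_cat. Qed.

Lemma lin_sandwich G c u p w :
  lin G (sandwich c u p w) = c * lin (fun x => G (u ++ x ++ w)) p.
Proof.
rewrite /lin /sandwich big_map mulr_sumr.
by apply: eq_bigr => cm _ /=; rewrite mulrA.
Qed.

Lemma coefE p x : coef p x = lin (fun y => (y == x)%:R) p.
Proof.
rewrite /coef /lin big_mkcond /=; apply: eq_bigr => cm _.
by case: eqP => _; rewrite ?mulr1 ?mulr0.
Qed.

Lemma lin_coefE G p (X : seq (word n)) : uniq X ->
  {subset [seq cm.2 | cm <- p] <= X} -> lin G p = \sum_(x <- X) coef p x * G x.
Proof.
move=> uX sX; under eq_bigr => x _ do rewrite /coef big_distrl /=.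
rewrite (exchange_big_dep predT) //= /lin [LHS]big_seq [RHS]big_seq.
apply: eq_bigr => cm cmp.
rewrite (eq_bigl (pred1 cm.2)) => [|x]; last by rewrite /= eq_sym.
by rewrite -big_filter filter_pred1_uniq ?big_seq1 //; apply/sX/map_f.
Qed.

(* A linear functional on combinations of words factors through [coef]. *)
Lemma lin_coefB G p p' r : (forall x, coef p x - coef p' x = coef r x) ->
  lin G p - lin G p' = lin G r.
Proof.
move=> e; set ws := fun s : Defs.poly F n => [seq cm.2 | cm <- s].
pose X := undup (ws p ++ ws p' ++ ws r).
have uX : uniq X := undup_uniq _.
rewrite !(@lin_coefE _ _ X) //; last first.
- by move=> x xs; rewrite mem_undup !mem_cat xs.
- by move=> x xs; rewrite mem_undup !mem_cat xs orbT.
- by move=> x xs; rewrite mem_undup !mem_cat xs !orbT.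
by rewrite -sumrB; apply: eq_bigr => x _; rewrite -mulrBl e.
Qed.

End LinearExtension.

(** * Congruence modulo the ideal, and spans of sets of words *)

Section Spanning.
Variables (F : fieldType) (n : nat) (q : F) (k : nat).
Implicit Types (p r : Defs.poly F n) (u v w : word n) (S : word n -> Prop).

Local Notation "p ~~ r" := (cl_eq q k p r) (at level 70).

Lemma in_ideal_cat p r : in_ideal q k p -> in_ideal q k r -> in_ideal q k (p ++ r).
Proof.
move=> ip ir; elim: ip => //= c u s w p' rs _ IH.
by rewrite -catA; apply: in_ideal_cons.
Qed.

Lemma in_ideal_sandwich c u p w : in_ideal q k p -> in_ideal q k (sandwich c u p w).
Proof.
elim=> [|d u' s w' p' rs _ IH]; first exact: in_ideal_nil.
rewrite /sandwich map_cat -/(sandwich c u p' w) -map_comp.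
rewrite (_ : map _ s = sandwich (c * d) (u ++ u') s (w' ++ w)).
  exact: in_ideal_cons.
by apply: eq_map => cm /=; rewrite mulrA !catA.
Qed.

Lemma cl_eq_coef p p' : (forall x, coef p x = coef p' x) -> p ~~ p'.
Proof.
move=> e; exists [::]; split; first exact: in_ideal_nil.
by move=> x; rewrite e subrr /coef big_nil.
Qed.

Lemma cl_eq_trans p p' r : p ~~ p' -> p' ~~ r -> p ~~ r.
Proof.
move=> [i [ii ei]] [j [ij ej]]; exists (i ++ j); split; first exact: in_ideal_cat.
by move=> x; rewrite [RHS]coefE lin_cat -!coefE -ei -ej addrA subrK.
Qed.

Lemma cl_eq_cat p p' r r' : p ~~ p' -> r ~~ r' -> p ++ r ~~ p' ++ r'.
Proof.
move=> [i [ii ei]] [j [ij ej]]; exists (i ++ j); split; first exact: in_ideal_cat.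
move=> x; rewrite [coef (p ++ r) x]coefE [coef (p' ++ r') x]coefE.
by rewrite [RHS]coefE !lin_cat -!coefE -ei -ej; ring.
Qed.

Lemma cl_eq_sandwich c u w p p' : p ~~ p' -> sandwich c u p w ~~ sandwich c u p' w.
Proof.
move=> [i [ii ei]]; exists (sandwich c u i w); split; first exact: in_ideal_sandwich.
by move=> x; rewrite !coefE !lin_sandwich -mulrBr (lin_coefB _ ei).
Qed.

Lemma cl_eq_rel r : is_rel q k r -> r ~~ [::].
Proof.
move=> hr; exists (sandwich 1 [::] r [::] ++ [::]); split.
  exact/in_ideal_cons/in_ideal_nil.
move=> x; rewrite cats0 [RHS]coefE lin_sandwich mul1r /coef big_nil subr0 /lin.
rewrite big_mkcond; apply: eq_bigr => cm _ /=.
by rewrite cats0; case: eqP => _; rewrite ?mulr1 ?mulr0.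
Qed.

Definition scale (c : F) p := sandwich c [::] p [::].

Lemma lin_scale G c p : lin G (scale c p) = c * lin G p.
Proof.
by rewrite lin_sandwich; congr (_ * _); apply: eq_bigr => cm _ /=; rewrite cats0.
Qed.

Definition spn S p :=
  exists p', (forall cm, cm \in p' -> S cm.2) /\ p ~~ p'.

Notation spw S w := (spn S [:: (1, w)]).

Lemma spn0 S : spn S [::].
Proof. by exists [::]; split => //; apply: cl_eq_coef. Qed.

Lemma spn_eq S p p' : p ~~ p' -> spn S p' -> spn S p.
Proof. by move=> e [r [rS er]]; exists r; split => //; apply: cl_eq_trans e er. Qed.

Lemma spn_cat S p r : spn S p -> spn S r -> spn S (p ++ r).
Proof.
move=> [p' [pS ep]] [r' [rS er]]; exists (p' ++ r'); split; last exact: cl_eq_cat.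
by move=> cm; rewrite mem_cat => /orP[/pS|/rS].
Qed.

Lemma spn_ctx S c u p v : spn S p ->
  spn (fun x => exists2 w, S w & x = u ++ w ++ v) (sandwich c u p v).
Proof.
move=> [p' [pS ep]]; exists (sandwich c u p' v); split; last exact: cl_eq_sandwich.
by move=> cm /mapP[dm /pS dS ->] /=; exists dm.2.
Qed.

Lemma spn_sub S S' p : (forall w, S w -> S' w) -> spn S p -> spn S' p.
Proof. by move=> SS' [p' [pS ep]]; exists p'; split => // cm /pS/SS'. Qed.

Lemma spn_scale S c p : spn S p -> spn S (scale c p).
Proof. by move/(spn_ctx c [::] [::]); apply: spn_sub => _ [w Sw ->]; rewrite cats0. Qed.

Lemma spw_mem S w : S w -> spw S w.
Proof.
move=> Sw; exists [:: (1, w)]; split; last exact: cl_eq_coef.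
by move=> cm; rewrite inE => /eqP->.
Qed.

Lemma spn_words S p : (forall cm, cm \in p -> spw S cm.2) -> spn S p.
Proof.
elim: p => [|[c w] p IH] pS; first exact: spn0.
apply: (@spn_cat _ [:: (c, w)] p).
  have := spn_scale c (pS _ (mem_head _ _)).
  by rewrite /scale /sandwich /= mulr1 cats0.
by apply: IH => cm cmp; apply: pS; rewrite inE cmp orbT.
Qed.

Lemma spn_trans S S' p : spn S p -> (forall w, S w -> spw S' w) -> spn S' p.
Proof.
by move=> [p' [pS ep]] SS'; apply: spn_eq ep _; apply: spn_words => cm /pS/SS'.
Qed.

Lemma spw_ctx S u w v : spw S w ->
  spw (fun x => exists2 y, S y & x = u ++ y ++ v) (u ++ w ++ v).
Proof. by move/(spn_ctx 1 u v); rewrite /sandwich /= mulr1. Qed.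

Lemma spw_ctx_trans S S' u w v :
  spw S w -> (forall y, S y -> spw S' (u ++ y ++ v)) -> spw S' (u ++ w ++ v).
Proof.
by move=> /(spw_ctx u v) h SS'; apply: spn_trans h _ => _ [y Sy ->]; apply: SS'.
Qed.

Lemma cl_eq_solve c w p : c != 0 -> (c, w) :: p ~~ [::] ->
  [:: (1, w)] ~~ scale (- c^-1) p.
Proof.
move=> c0 /(cl_eq_sandwich c^-1 [::] [::]) e.
have /(cl_eq_cat e) : scale (- c^-1) p ~~ scale (- c^-1) p by apply: cl_eq_coef.
apply: cl_eq_trans; apply: cl_eq_coef => x.
rewrite !coefE lin_cat -/(scale _ _) !lin_scale !lin_cons lin_nil /=.
by field.
Qed.

(* Modulo the ideal, [w] is a linear combination of [L]; quantifying over the contexts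
   [u], [v] and the target [S] turns each such fact into a rewriting rule. *)
Definition reduces w (L : seq (word n)) :=
  forall S u v, (forall y, y \in L -> spw S (u ++ y ++ v)) -> spw S (u ++ w ++ v).

(** Any term with a nonzero coefficient can be solved for. The coefficients of the other terms are
    forgotten, since spanning only asks which words occur. *)
Lemma reduces_solve p c w p' : c != 0 -> p ++ (c, w) :: p' ~~ [::] ->
  reduces w [seq cm.2 | cm <- p ++ p'].
Proof.
move=> c0 e S u v H.
suff : spw (fun y => y \in [seq cm.2 | cm <- p ++ p']) w.
  by move/spw_ctx_trans; apply.
have {e} /(cl_eq_solve c0) : (c, w) :: p ++ p' ~~ [::].
  apply: cl_eq_trans e; apply: cl_eq_coef => x.
  by rewrite /coef -cat_cons (perm_big _ (permEl (perm_catCA [:: (c, w)] p p'))).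
move/spn_eq; apply; apply/spn_scale/spn_words => cm cmp.
by apply: spw_mem; apply: map_f.
Qed.

Definition mono (a : 'I_n) (tau : bool * bool * 'I_(4 * k)) : word n :=
  nseq tau.1.1 (Psi, a) ++ nseq tau.1.2 (PsiS, a) ++ nseq tau.2 (Om, a).

Definition adm (tau : bool * bool * 'I_(4 * k)) : bool :=
  ((tau.1.1 : nat) + tau.1.2 < 2)%N &&
  (((tau.1.1 : nat) + tau.1.2 == 1)%N ==> (tau.2 <= 2 * k - 1)%N).

(** * Spanning for the generators of a single index *)

Section OneIndex.
Variable a : 'I_n.
Hypotheses (char2 : (2%:R : F) != 0) (q0 : q != 0) (hq : q ^+ (2 * k) != 1).

Let psi := (Psi, a).
Let psiS := (PsiS, a).
Let om := (Om, a).
Let omI := (OmInv, a).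
Let O m := nseq m om.
Let I m := nseq m omI.

Lemma reduces_omI_om : reduces [:: omI; om] [:: [::]].
Proof.
apply: (@reduces_solve [::] 1 _ [:: (-1, [::])]); first exact: oner_neq0.
by apply: cl_eq_rel; exists a, a; do 2 right; left.
Qed.

(** The relation is also read backwards, because later arguments insert cancelling pairs of powers
    of omega. *)
Lemma reduces_nil_omI_om : reduces [::] [:: [:: omI; om]].
Proof.
apply: (@reduces_solve [:: (1, [:: omI; om])] (-1) _ [::]).
  by rewrite oppr_eq0 oner_neq0.
by apply: cl_eq_rel; exists a, a; do 2 right; left.
Qed.

Lemma nseqSr T m (x : T) : nseq m.+1 x = nseq m x ++ [:: x].
Proof. by rewrite -addn1 nseqD. Qed.

Lemma reduces_omI_om_pow m : reduces (I m ++ O m) [:: [::]].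
Proof.
elim: m => [|m IH] S u v H; first exact: H.
have := reduces_omI_om (S := S) (u := u ++ I m) (v := O m ++ v).
rewrite /I nseqSr -/(I m) -!catA; apply => y; rewrite inE => /eqP->.
by rewrite -catA; have := IH S u v; rewrite -catA; apply.
Qed.

Lemma reduces_nil_omI_om_pow m : reduces [::] [:: I m ++ O m].
Proof.
elim: m => [|m IH] S u v H; first exact: H.
apply: IH => y; rewrite inE => /eqP->; rewrite -catA.
have := reduces_nil_omI_om (S := S) (u := u ++ I m) (v := O m ++ v).
rewrite -catA; apply => y'; rewrite inE => /eqP->; rewrite -catA.
have := H (I m.+1 ++ O m.+1) (mem_head _ _).
by rewrite {1}/I nseqSr -/(I m) -!catA.
Qed.

(** Anticommutation of [x] with itself gives 2 x^2 = 0, and characteristic different from 2 allows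
    dividing by 2. The empty list on the right means that the word is zero in the algebra. *)
Lemma reduces_sqr_zero x : [:: (1, [:: x; x]); (1, [:: x; x])] ~~ [::] ->
  reduces [:: x; x] [::].
Proof.
move=> e; apply: (@reduces_solve [::] 2%:R _ [::]) => //.
apply: cl_eq_trans e; apply: cl_eq_coef => y.
by rewrite !coefE !lin_cons lin_nil /=; ring.
Qed.

Lemma reduces_psi_psi : reduces [:: psi; psi] [::].
Proof.
by apply: reduces_sqr_zero; apply: cl_eq_rel; exists a, a; do 5 right; left.
Qed.

Lemma reduces_psiS_psiS : reduces [:: psiS; psiS] [::].
Proof.
by apply: reduces_sqr_zero; apply: cl_eq_rel; exists a, a; do 6 right; left.
Qed.

Let rel_omI : [:: (1, [:: psi; psiS]); (q ^+ k, [:: psiS; psi]); (-1, I k)] ~~ [::].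
Proof. by apply: cl_eq_rel; exists a, a; do 7 right; left. Qed.

Let rel_om : [:: (1, [:: psi; psiS]); ((q ^+ k)^-1, [:: psiS; psi]); (-1, O k)] ~~ [::].
Proof. by apply: cl_eq_rel; exists a, a; do 8 right; left. Qed.

Let qk0 : q ^+ k != 0.
Proof. exact: expf_neq0. Qed.

Let N1 : (-1 : F) != 0.
Proof. by rewrite oppr_eq0 oner_neq0. Qed.

Lemma cl_eq_comb c d p r : p ~~ [::] -> r ~~ [::] -> scale c p ++ scale d r ~~ [::].
Proof.
move=> ep er.
exact: cl_eq_cat (cl_eq_sandwich c [::] [::] ep) (cl_eq_sandwich d [::] [::] er).
Qed.

(** The multiplier q^(2k) makes the two [psiS psi] terms cancel, as q^(2k) q^(-k) = q^k. *)
Lemma rel_psi_psiS : [:: (1 - q ^+ (2 * k), [:: psi; psiS]);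
  (q ^+ (2 * k), O k); (-1, I k)] ~~ [::].
Proof.
have := cl_eq_comb 1 (- q ^+ (2 * k)) rel_omI rel_om.
apply: cl_eq_trans; apply: cl_eq_coef => x.
rewrite !coefE lin_cat !lin_scale !lin_cons lin_nil /= mulnC exprM.
by field.
Qed.

Lemma rel_psiS_psi : [:: (q ^+ k - (q ^+ k)^-1, [:: psiS; psi]);
  (1, O k); (-1, I k)] ~~ [::].
Proof.
have := cl_eq_comb 1 (- 1) rel_omI rel_om.
apply: cl_eq_trans; apply: cl_eq_coef => x.
by rewrite !coefE lin_cat !lin_scale !lin_cons lin_nil /=; ring.
Qed.

(** Expanding omega^k as a combination of [psi psiS] and [psiS psi] after a [psi], the first term
    contains [psi psi] and dies. *)
Lemma reduces_psi_om : reduces (psi :: O k) [:: [:: psi; psiS; psi]].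
Proof.
have r : reduces (O k) [:: [:: psi; psiS]; [:: psiS; psi]].
  exact: (@reduces_solve [:: _; _] _ _ [::] N1 rel_om).
move=> S u v H; have := r S (u ++ [:: psi]) v; rewrite -catA; apply => y.
rewrite !inE => /orP[]/eqP->; rewrite -catA; last exact: (H _ (mem_head _ _)).
by apply: (reduces_psi_psi (v := psiS :: v)).
Qed.

Lemma reduces_psi_psiS_psi : reduces [:: psi; psiS; psi] [:: psi :: I k].
Proof.
have r : reduces [:: psiS; psi] [:: [:: psi; psiS]; I k].
  exact: (@reduces_solve [:: _] _ _ _ qk0 rel_omI).
move=> S u v H; have := r S (u ++ [:: psi]) v; rewrite -catA; apply => y.
rewrite !inE => /orP[]/eqP->; rewrite -catA; last exact: (H _ (mem_head _ _)).
by apply: (reduces_psi_psi (v := psiS :: v)).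
Qed.

(** One block omega^k becomes omega^(-k) by a detour through [psi psiS psi], using one of the two
    relations each way; the other block then cancels it. *)
Lemma reduces_psi_om2k : reduces (psi :: O k ++ O k) [:: [:: psi]].
Proof.
move=> S u v H; rewrite /= -catA.
apply: (reduces_psi_om (v := O k ++ v)) => y; rewrite inE => /eqP->.
apply: (reduces_psi_psiS_psi (v := O k ++ v)) => y'; rewrite inE => /eqP->.
have := @reduces_omI_om_pow k S (u ++ [:: psi]) v.
rewrite -!catA; apply => y2; rewrite inE => /eqP->; rewrite -catA.
exact: (H _ (mem_head _ _)).
Qed.

Lemma reduces_psiS_om : reduces (psiS :: O k) [:: [:: psiS; psi; psiS]].
Proof.
have r : reduces (O k) [:: [:: psi; psiS]; [:: psiS; psi]].
  exact: (@reduces_solve [:: _; _] _ _ [::] N1 rel_om).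
move=> S u v H; have := r S (u ++ [:: psiS]) v; rewrite -catA; apply => y.
rewrite !inE => /orP[]/eqP->; rewrite -catA; first exact: (H _ (mem_head _ _)).
by apply: (reduces_psiS_psiS (v := psi :: v)).
Qed.

Lemma reduces_psiS_omI : reduces (psiS :: I k) [:: [:: psiS; psi; psiS]].
Proof.
have r : reduces (I k) [:: [:: psi; psiS]; [:: psiS; psi]].
  exact: (@reduces_solve [:: _; _] _ _ [::] N1 rel_omI).
move=> S u v H; have := r S (u ++ [:: psiS]) v; rewrite -catA; apply => y.
rewrite !inE => /orP[]/eqP->; rewrite -catA; first exact: (H _ (mem_head _ _)).
by apply: (reduces_psiS_psiS (v := psi :: v)).
Qed.

Lemma reduces_psiS_psi_psiS_omI : reduces [:: psiS; psi; psiS] [:: psiS :: I k].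
Proof.
have r : reduces [:: psi; psiS] [:: [:: psiS; psi]; I k].
  exact: (@reduces_solve [::] _ _ _ (oner_neq0 _) rel_omI).
move=> S u v H; have := r S (u ++ [:: psiS]) v; rewrite -catA; apply => y.
rewrite !inE => /orP[]/eqP->; rewrite -catA; last exact: (H _ (mem_head _ _)).
by apply: (reduces_psiS_psiS (v := psi :: v)).
Qed.

Lemma reduces_psiS_psi_psiS_om : reduces [:: psiS; psi; psiS] [:: psiS :: O k].
Proof.
have r : reduces [:: psi; psiS] [:: [:: psiS; psi]; O k].
  exact: (@reduces_solve [::] _ _ _ (oner_neq0 _) rel_om).
move=> S u v H; have := r S (u ++ [:: psiS]) v; rewrite -catA; apply => y.
rewrite !inE => /orP[]/eqP->; rewrite -catA; last exact: (H _ (mem_head _ _)).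
by apply: (reduces_psiS_psiS (v := psi :: v)).
Qed.

Lemma reduces_psiS_om2k : reduces (psiS :: O k ++ O k) [:: [:: psiS]].
Proof.
move=> S u v H; rewrite /= -catA.
apply: (reduces_psiS_om (v := O k ++ v)) => y; rewrite inE => /eqP->.
apply: (reduces_psiS_psi_psiS_omI (v := O k ++ v)) => y'; rewrite inE => /eqP->.
have := @reduces_omI_om_pow k S (u ++ [:: psiS]) v.
rewrite -!catA; apply => y2; rewrite inE => /eqP->; rewrite -catA.
exact: (H _ (mem_head _ _)).
Qed.

(** The converse direction of the previous rule, which raises exponents: insert omega^(-k) omega^k
    and convert the negative block into a positive one through [psiS psi psiS]. *)
Lemma reduces_psiS_to_om2k : reduces [:: psiS] [:: psiS :: O k ++ O k].
Proof.
move=> S u v H.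
have := @reduces_nil_omI_om_pow k S (u ++ [:: psiS]) v.
rewrite -!catA; apply => y; rewrite inE => /eqP->; rewrite -!catA.
apply: (reduces_psiS_omI (v := O k ++ v)) => y1; rewrite inE => /eqP->.
apply: (reduces_psiS_psi_psiS_om (v := O k ++ v)) => y2; rewrite inE => /eqP->.
by have := H _ (mem_head _ _); rewrite /= -catA.
Qed.

Let q2k0 : q ^+ (2 * k) != 0.
Proof. exact: expf_neq0. Qed.

Lemma reduces_om_pow : reduces (O k) [:: [:: psi; psiS]; I k].
Proof. exact: (@reduces_solve [:: _] _ _ _ q2k0 rel_psi_psiS). Qed.

Lemma reduces_omI_pow : reduces (I k) [:: [:: psi; psiS]; O k].
Proof. exact: (@reduces_solve [:: _; _] _ _ [::] N1 rel_psi_psiS). Qed.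

Lemma reduces_psi_psiS : reduces [:: psi; psiS] [:: O k; I k].
Proof.
by apply: (@reduces_solve [::] _ _ _ _ rel_psi_psiS); rewrite subr_eq0 eq_sym.
Qed.

Lemma reduces_psiS_psi : reduces [:: psiS; psi] [:: O k; I k].
Proof.
apply: (@reduces_solve [::] _ _ _ _ rel_psiS_psi); rewrite subr_eq0.
apply: contra hq => /eqP e; apply/eqP.
by rewrite mul2n -addnn exprD {1}e mulVf.
Qed.

(** The first block is a combination of [psi psiS] and omega^(-k). In the first case [psiS] absorbs
    the remaining omega^(2k) and [psi psiS] is expanded back; in the second one block cancels. *)
Lemma reduces_om3k : reduces (O k ++ O k ++ O k) [:: O k; I k].
Proof.
move=> S u v H; rewrite -!catA.
apply: (reduces_om_pow (v := O k ++ O k ++ v)) => y; rewrite !inE => /orP[]/eqP->.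
  have := reduces_psiS_om2k (u := u ++ [:: psi]) (v := v).
  rewrite /= -!catA; apply => y1; rewrite inE => /eqP->; rewrite -catA.
  exact: reduces_psi_psiS.
have := @reduces_omI_om_pow k S u (O k ++ v).
rewrite -!catA; apply => y1; rewrite inE => /eqP->.
by apply: H; rewrite inE eqxx.
Qed.

Lemma reduces_om4k : reduces (O (4 * k)) [:: O (2 * k); [::]].
Proof.
have -> : O (4 * k) = (O k ++ O k ++ O k) ++ O k.
  by rewrite /O -!nseqD; congr nseq; lia.
move=> S u v H; rewrite -!catA.
have := reduces_om3k (S := S) (u := u) (v := O k ++ v).
rewrite -!catA; apply => y; rewrite !inE => /orP[]/eqP->.
  have := H (O (2 * k)) (mem_head _ _).
  by rewrite /O mul2n -addnn nseqD -catA.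
rewrite [_ ++ _ ++ v]catA; apply: reduces_omI_om_pow => y1; rewrite inE => /eqP->.
by apply: H; rewrite !inE eqxx orbT.
Qed.

(** Write omega^(-k) through [psi psiS] and omega^k, let [psiS] create a factor omega^(2k), then
    expand [psi psiS] as a combination of omega^k and omega^(-k). Every resulting exponent is
    positive. *)
Lemma reduces_omI_pow_om : reduces (I k) [:: O (3 * k); O k].
Proof.
have -> : O (3 * k) = O k ++ O k ++ O k by rewrite /O -!nseqD; congr nseq; lia.
move=> S u v H; apply: reduces_omI_pow => y; rewrite !inE => /orP[]/eqP->; last first.
  by apply: H; rewrite !inE eqxx orbT.
have := reduces_psiS_to_om2k (S := S) (u := u ++ [:: psi]) (v := v).
rewrite -!catA; apply => y1; rewrite inE => /eqP->; rewrite -!catA /= -!catA.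
apply: (reduces_psi_psiS (v := O k ++ O k ++ v)) => y2; rewrite !inE => /orP[]/eqP->.
  by have := H _ (mem_head _ _); rewrite -!catA.
have := @reduces_omI_om_pow k S u (O k ++ v).
rewrite -!catA; apply => y3; rewrite inE => /eqP->.
by apply: H; rewrite !inE eqxx orbT.
Qed.

Lemma reduces_omI : (0 < k)%N -> reduces [:: omI] [:: O (4 * k - 1); O (2 * k - 1)].
Proof.
move=> k0 S u v H.
(* Inserting omega^(-(k-1)) omega^(k-1) completes the single inverse to omega^(-k); the leftover
   omega^(k-1) explains the exponents 4k-1 and 2k-1. *)
have := @reduces_nil_omI_om_pow k.-1 S (u ++ [:: omI]) v.
rewrite -!catA; apply => y; rewrite inE => /eqP->; rewrite -!catA.
have := reduces_omI_pow_om (S := S) (u := u) (v := O k.-1 ++ v).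
have -> : I k = omI :: I k.-1 by rewrite -{1}(prednK k0).
apply => y1; rewrite !inE.
case/orP=> /eqP->; rewrite [O _ ++ _ ++ v]catA /O -nseqD.
  by apply: H; rewrite /O (_ : (3 * k + k.-1 = 4 * k - 1)%N) ?mem_head //; lia.
by apply: H; rewrite /O (_ : (k + k.-1 = 2 * k - 1)%N) ?inE ?eqxx ?orbT //; lia.
Qed.

Hypothesis k0 : (0 < k)%N.

Let Loc w := exists2 tau, adm tau & w = mono a tau.

Lemma spw_om_pow (v : nat) : spw Loc (O v).
Proof.
elim/ltn_ind: v => v IH; case: (ltnP v (4 * k)) => hv.
  by apply: spw_mem; exists (false, false, Ordinal hv).
(* The rule for omega^(4k) lowers the exponent to v - 2k or v - 4k, both covered by the strong
   induction. *)
have -> : O v = [::] ++ O (4 * k) ++ O (v - 4 * k).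
  by rewrite /O cat0s -nseqD subnKC.
apply: (reduces_om4k) => y; rewrite !inE => /orP[]/eqP->; last by apply: IH; lia.
by rewrite cat0s /O -nseqD; apply: IH; lia.
Qed.

Lemma spw_psi_om_pow (v : nat) : spw Loc (psi :: O v).
Proof.
elim/ltn_ind: v => v IH; case: (ltnP v (2 * k)) => hv.
  have hv4 : (v < 4 * k)%N by lia.
  by apply: spw_mem; exists (true, false, Ordinal hv4) => //; rewrite /adm /=; lia.
have -> : psi :: O v = [::] ++ (psi :: O k ++ O k) ++ O (v - 2 * k).
  rewrite /O /= -!nseqD; congr (_ :: nseq _ _); lia.
apply: reduces_psi_om2k => y; rewrite !inE => /eqP->.
by apply: IH; lia.
Qed.

Lemma spw_psiS_om_pow (v : nat) : spw Loc (psiS :: O v).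
Proof.
elim/ltn_ind: v => v IH; case: (ltnP v (2 * k)) => hv.
  have hv4 : (v < 4 * k)%N by lia.
  by apply: spw_mem; exists (false, true, Ordinal hv4) => //; rewrite /adm /=; lia.
have -> : psiS :: O v = [::] ++ (psiS :: O k ++ O k) ++ O (v - 2 * k).
  rewrite /O /= -!nseqD; congr (_ :: nseq _ _); lia.
apply: reduces_psiS_om2k => y; rewrite !inE => /eqP->.
by apply: IH; lia.
Qed.

Lemma spw_om_pow_pm (v : nat) y : y \in [:: O k; I k] -> spw Loc (y ++ O v).
Proof.
rewrite !inE => /orP[]/eqP->; first by rewrite /O -nseqD; apply: spw_om_pow.
apply: (reduces_omI_pow_om (u := [::])) => y'; rewrite !inE.
by case/orP=> /eqP->; rewrite cat0s /O -nseqD; apply: spw_om_pow.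
Qed.

Lemma reduces_om_psi b c : reduces [:: (Om, b); (Psi, c)] [:: [:: (Psi, c); (Om, b)]].
Proof.
apply: (@reduces_solve [::] 1 _ [:: (- qpow q (b == c), _)]); first exact: oner_neq0.
by apply: cl_eq_rel; exists b, c; do 3 right; left.
Qed.

Lemma reduces_om_psiS b c : reduces [:: (Om, b); (PsiS, c)] [:: [:: (PsiS, c); (Om, b)]].
Proof.
apply: (@reduces_solve [::] 1 _ [:: (- qinvpow q (b == c), _)]); first exact: oner_neq0.
by apply: cl_eq_rel; exists b, c; do 4 right; left.
Qed.

(** Nine cases: a square vanishes, a product of [psi] and [psiS] in either order becomes powers of
    omega, an omega moves to the right and raises the exponent, and otherwise the word is already
    ordered. Exponents that grow too large are handled by the preceding lemmas. *)
Lemma spw_gen_mono g tau : g != OmInv -> adm tau -> spw Loc ((g, a) :: mono a tau).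
Proof.
case: tau => [[[] []] [v hv]] gI; rewrite /adm /mono //= => _;
  case: g gI => [_|_|_|/eqP[]] //.
- exact: (reduces_psi_psi (u := [::])).
- by apply: (reduces_psiS_psi (u := [::])) => y; apply: spw_om_pow_pm.
- apply: (reduces_om_psi (u := [::])) => y; rewrite inE => /eqP->.
  exact: (spw_psi_om_pow v.+1).
- by apply: (reduces_psi_psiS (u := [::])) => y; apply: spw_om_pow_pm.
- exact: (reduces_psiS_psiS (u := [::])).
- apply: (reduces_om_psiS (u := [::])) => y; rewrite inE => /eqP->.
  exact: (spw_psiS_om_pow v.+1).
- exact: spw_psi_om_pow.
- exact: spw_psiS_om_pow.
- exact: (spw_om_pow v.+1).
Qed.

End OneIndex.

(** * Spanning for all indices together *)

Hypotheses (char2 : (2%:R : F) != 0) (q0 : q != 0) (hq : q ^+ (2 * k) != 1).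
Hypothesis k0 : (0 < k)%N.

Lemma reduces_swap g h (a b : 'I_n) : a != b -> g != OmInv -> h != OmInv ->
  reduces [:: (g, a); (h, b)] [:: [:: (h, b); (g, a)]].
Proof.
move=> ab gI hI; have ba : b != a by rewrite eq_sym.
have N1 : (-1 : F) != 0 by rewrite oppr_eq0 oner_neq0.
case: g gI => [_|_|_|/eqP[]] //; case: h hI => [_|_|_|/eqP[]] //.
- apply: (@reduces_solve [::] 1 _ [:: (1, _)]); first exact: oner_neq0.
  by apply: cl_eq_rel; exists a, b; do 5 right; left.
- apply: (@reduces_solve [::] 1 _ [:: (1, _)]); first exact: oner_neq0.
  by apply: cl_eq_rel; exists a, b; do 9 right.
- apply: (@reduces_solve [:: (1, _)] (-1) _ [::]) => //.
  apply: cl_eq_rel; exists b, a; do 3 right; left.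
  by rewrite /qpow (negPf ba).
- apply: (@reduces_solve [:: (1, _)] 1 _ [::]); first exact: oner_neq0.
  by apply: cl_eq_rel; exists b, a; do 9 right.
- apply: (@reduces_solve [::] 1 _ [:: (1, _)]); first exact: oner_neq0.
  by apply: cl_eq_rel; exists a, b; do 6 right; left.
- apply: (@reduces_solve [:: (1, _)] (-1) _ [::]) => //.
  apply: cl_eq_rel; exists b, a; do 4 right; left.
  by rewrite /qinvpow (negPf ba).
- exact: reduces_om_psi.
- exact: reduces_om_psiS.
- apply: (@reduces_solve [::] 1 _ [:: (-1, _)]); first exact: oner_neq0.
  by apply: cl_eq_rel; exists a, b; left.
Qed.

Lemma reduces_swap_word g (a : 'I_n) w : g != OmInv ->
  all (fun x => (x.1 != OmInv) && (x.2 != a)) w ->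
  reduces ((g, a) :: w) [:: w ++ [:: (g, a)]].
Proof.
move=> gI; elim: w => [|[h b] w IH] /=; first by move=> _ S u v; apply; apply: mem_head.
case/andP=> /andP[hI ba] /IH{}IH S u v H.
have := @reduces_swap g h a b; rewrite eq_sym => /(_ ba gI hI S u (w ++ v)); apply.
move=> y; rewrite inE => /eqP->.
have := @IH S (u ++ [:: (h, b)]) v; rewrite -!catA; apply => y'; rewrite inE => /eqP->.
by have := H _ (mem_head _ _); rewrite /= -!catA /= -?catA.
Qed.

Definition basis_word w := exists2 t : bidx n k, admissible t & w = bmono t.

Lemma all_mono a tau : all (fun x => (x.1 != OmInv) && (x.2 == a)) (mono a tau).
Proof.
have [h1 h2 h3] : [/\ Psi != OmInv, PsiS != OmInv & Om != OmInv].
  by split; apply/eqP.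
by rewrite /mono !all_cat !all_nseq /= eqxx h1 h2 h3 !orbT.
Qed.

Lemma flatten_mono_update (s : seq 'I_n) (t t' : bidx n k) a : a \notin s ->
  (forall b, b != a -> t' b = t b) ->
  flatten [seq mono b (t' b) | b <- s] = flatten [seq mono b (t b) | b <- s].
Proof.
move=> as_ tt'; congr flatten; apply/eq_in_map => b bs; rewrite tt' //.
by apply: contraNneq as_ => <-.
Qed.

(** The generator travels past the blocks preceding that of index [a], up to scalars, and is
    absorbed there by the one-index result; the other blocks do not change. *)
Lemma spw_gen_bmono g a (t : bidx n k) : g != OmInv -> admissible t ->
  spw basis_word ((g, a) :: bmono t).
Proof.
move=> gI adt; have /forallP adta := adt.
have [s1 [s2 E]] : exists s1 s2, enum 'I_n = s1 ++ a :: s2.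
  have : a \in enum 'I_n by rewrite mem_enum.
  by case/splitPr => s1 s2; exists s1, s2.
have := enum_uniq 'I_n; rewrite E cat_uniq /= => /and3P[_ /norP[as1 _] /andP[as2 _]].
have bE (t' : bidx n k) : bmono t' = flatten [seq mono b (t' b) | b <- s1]
    ++ mono a (t' a) ++ flatten [seq mono b (t' b) | b <- s2].
  by rewrite /bmono E map_cat flatten_cat.
rewrite bE; set X := flatten _; set Y := flatten _.
have /(reduces_swap_word gI) r : all (fun x => (x.1 != OmInv) && (x.2 != a)) X.
  apply/allP => x /flattenP[w /mapP[b bs ->]].
  move/(allP (all_mono b (t b))) => /andP[-> /eqP->] /=.
  by apply: contraNneq as1 => <-.
apply: (r basis_word [::] (mono a (t a) ++ Y)) => y; rewrite inE => /eqP->.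
rewrite cat0s -catA; have := spw_gen_mono a char2 q0 hq k0 gI (adta a).
move=> h; apply: (spw_ctx_trans (w := (g, a) :: mono a (t a)) h) => _ [tau ad ->].
pose t' : bidx n k := [ffun b => if b == a then tau else t b].
apply: spw_mem; exists t'.
  by apply/forallP => b; rewrite ffunE; case: eqP => _; [apply: ad | apply: adta].
have tt' b : b != a -> t' b = t b by rewrite ffunE => /negPf->.
rewrite bE !(flatten_mono_update (t := t) (a := a)) //.
by rewrite ffunE eqxx.
Qed.

Lemma spw_gen x w : spw basis_word w -> spw basis_word (x :: w).
Proof.
have step g a v : g != OmInv -> spw basis_word v -> spw basis_word ((g, a) :: v).
  move=> gI h; have := @spw_ctx_trans basis_word basis_word [:: (g, a)] v [::] h.
  rewrite cats0; apply => _ [t adt ->]; rewrite cats0.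
  exact: spw_gen_bmono.
case: x => g a; case: (eqVneq g OmInv) => [->|]; last exact: step.
(* An inverse is traded for nonnegative powers of omega, which are multiplied in one letter at a
   time. *)
move=> h; apply: (reduces_omI (a := a) char2 q0 hq k0 (u := [::])).
suff pow m : spw basis_word (nseq m (Om, a) ++ w).
  by move=> y; rewrite !inE => /orP[]/eqP->; apply: pow.
by elim: m => [|m IHm] //=; apply: step IHm; apply/eqP.
Qed.

Lemma bmono_nil : exists2 t : bidx n k, admissible t & bmono t = [::].
Proof.
have h : (0 < 4 * k)%N by lia.
exists [ffun => (false, false, Ordinal h)].
  by apply/forallP => a; rewrite !ffunE.
rewrite /bmono; elim: (enum _) => //= a s IH.
by rewrite !ffunE.
Qed.

Lemma spw_all w : spw basis_word w.
Proof.
elim: w => [|x w]; last exact: spw_gen.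
by have [t adt e] := bmono_nil; apply: spw_mem; exists t.
Qed.

Lemma lin_bcomb G (c : bidx n k -> F) :
  lin G (bcomb c) = \sum_(t | admissible t) c t * G (bmono t).
Proof. by rewrite /lin /bcomb big_map big_filter big_enum_cond. Qed.

Lemma spanning p : exists c : bidx n k -> F, cl_eq q k p (bcomb c).
Proof.
have [p' [pS ep]] : spn basis_word p by apply: spn_words => cm _; apply: spw_all.
suff [c ec] : exists c : bidx n k -> F, p' ~~ bcomb c.
  by exists c; apply: cl_eq_trans ep ec.
elim: p' pS {ep} => [|[d w] p' IH] pS.
  exists (fun=> 0); apply: cl_eq_coef => x; rewrite !coefE lin_nil lin_bcomb big1 //.
  by move=> t _; rewrite mul0r.
have [c ec] : exists c : bidx n k -> F, p' ~~ bcomb c.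
  by apply: IH => cm cmp; apply: pS; rewrite inE cmp orbT.
have [t0 adt0 /= ->] := pS _ (mem_head _ _).
(* The same basis word may occur several times in [p'], so coefficients are accumulated. *)
exists (fun t => (if t == t0 then d else 0) + c t).
apply: (@cl_eq_trans _ ([:: (d, bmono t0)] ++ bcomb c)).
  by apply: (@cl_eq_cat [:: _] _ _ _ _ ec); apply: cl_eq_coef.
apply: cl_eq_coef => x; rewrite !coefE lin_cat !lin_bcomb lin_cons lin_nil /= addr0.
under [RHS]eq_bigr => t _ do rewrite mulrDl.
rewrite big_split /=; congr (_ + _).
rewrite (bigD1 t0) //= eqxx big1 ?addr0 // => t /andP[_ /negPf->].
by rewrite mul0r.
Qed.

End Spanning.

(** * The representation, and its compatibility with the relations *)

Section Independence.
Variables (F : fieldType) (n : nat) (q : F) (k : nat).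
Hypotheses (q0 : q != 0) (k0 : (0 < k)%N) (hq : q ^+ (2 * k) != 1).

Local Notation L := (bool * 'Z_(2 * k))%type.
Implicit Types (b : 'I_n) (w : word n) (f : L -> F) (x y : L) (g : gkind) (t : bidx n k).
Implicit Type tau : bool * bool * 'I_(4 * k).

(* Operators act on functions of [x : L] by [(g f) x = gscal g x * f (gdest g x)], so a
   word is read from left to right along the orbit of [x]. *)
Definition gscal g x : F :=
  match g with
  | Psi => (~~ x.1)%:R
  | PsiS => x.1%:R
  | Om => if x.1 then q^-1 else 1
  | OmInv => if x.1 then q else 1
  end.

Definition gdest g x : L :=
  match g with
  | Psi => (true, x.2)
  | PsiS => (false, x.2 + k%:R)
  | Om => (x.1, x.2 + 1)
  | OmInv => (x.1, x.2 - 1)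
  end.

Definition odd_gen g := match g with Psi | PsiS => true | _ => false end.

(** The second branch is the Jordan-Wigner sign, which makes odd generators of different indices
    anticommute. *)
Definition lscal b (z : gkind * 'I_n) x : F :=
  if z.2 == b then gscal z.1 x
  else if [&& odd_gen z.1, (z.2 < b)%N & x.1] then -1 else 1.

Definition ldest b (z : gkind * 'I_n) x : L := if z.2 == b then gdest z.1 x else x.

Fixpoint wscal b w x : F :=
  if w is z :: w' then lscal b z x * wscal b w' (ldest b z x) else 1.

Fixpoint wdest b w x : L :=
  if w is z :: w' then wdest b w' (ldest b z x) else x.

Definition loc b w f x := wscal b w x * f (wdest b w x).

Lemma loc_cat b u w f x : loc b (u ++ w) f x = loc b u (loc b w f) x.
Proof.
elim: u x => [|z u IH] x; first by rewrite /loc /= mul1r.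
by have := IH (ldest b z x); rewrite /loc /= -!mulrA => ->.
Qed.

Lemma loc_cons b z w f x :
  loc b (z :: w) f x = lscal b z x * loc b w f (ldest b z x).
Proof. by rewrite /loc /= mulrA. Qed.

Lemma loc_nil b f x : loc b [::] f x = f x.
Proof. by rewrite /loc /= mul1r. Qed.

(** The value at the point [x] of the image under [w] of the pure tensor with factors [f b]. For
    indicator functions these are the matrix coefficients of the representation. *)
Definition tens (f : 'I_n -> L -> F) (x : 'I_n -> L) w : F :=
  \prod_b loc b w (f b) (x b).

Lemma tens_scale (eps : 'I_n -> F) w w' (f : 'I_n -> L -> F) (x : 'I_n -> L) :
  (forall b, loc b w (f b) (x b) = eps b * loc b w' (f b) (x b)) ->
  tens f x w = (\prod_b eps b) * tens f x w'.
Proof. by move=> e; rewrite /tens -big_split; apply: eq_bigr => b _. Qed.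

Lemma prod_delta (a : 'I_n) (e : F) : \prod_c (if c == a then e else 1) = e.
Proof. by rewrite -big_mkcond big_pred1_eq. Qed.

Lemma loc_om_om a b c f x :
  loc c [:: (Om, a); (Om, b)] f x = loc c [:: (Om, b); (Om, a)] f x.
Proof.
rewrite /loc /= /lscal /ldest /=.
by case: (a == c) (b == c) x => [] [] [[] i] /=; ring.
Qed.

Lemma loc_om_omI a c f x : loc c [:: (Om, a); (OmInv, a)] f x = f x.
Proof.
rewrite /loc /= /lscal /ldest /=.
by case: (a == c) x => [] [[] i] /=; rewrite ?addrK; field.
Qed.

Lemma loc_omI_om a c f x : loc c [:: (OmInv, a); (Om, a)] f x = f x.
Proof.
rewrite /loc /= /lscal /ldest /=.
by case: (a == c) x => [] [[] i] /=; rewrite ?subrK; field.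
Qed.

Lemma loc_om_psi a b c f x : loc c [:: (Om, a); (Psi, b)] f x =
  (if c == a then qpow q (a == b) else 1) * loc c [:: (Psi, b); (Om, a)] f x.
Proof.
rewrite /loc /= /lscal /ldest /= (eq_sym c a).
case: (eqVneq a c) => [->|_]; rewrite ?(eq_sym c b); case: (b == c) => /=;
  by case: (b < c)%N; case: x => [[] i] /=; rewrite /qpow; field.
Qed.

Lemma loc_om_psiS a b c f x : loc c [:: (Om, a); (PsiS, b)] f x =
  (if c == a then qinvpow q (a == b) else 1) * loc c [:: (PsiS, b); (Om, a)] f x.
Proof.
rewrite /loc /= /lscal /ldest /= (eq_sym c a).
case: (eqVneq a c) => [->|_]; rewrite ?(eq_sym c b); case: (b == c) => /=;
  case: (b < c)%N; case: x => [[] i] /=; rewrite /qinvpow -?addrA ?[1 + _]addrC;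
  by field.
Qed.

(** The sign appears only on the factor of the larger index: there one generator flips the bit while
    the other multiplies by (-1)^s. On every other factor the two actions commute. *)
Lemma loc_odd_odd g g' a b c f x : odd_gen g -> odd_gen g' -> a != b ->
  loc c [:: (g, a); (g', b)] f x =
  (if c == (if (a < b)%N then b else a) then -1 else 1) *
    loc c [:: (g', b); (g, a)] f x.
Proof.
move=> og og' ab; rewrite /loc /= /lscal /ldest /= og og' /= (eq_sym c).
case: (eqVneq a c) ab => [->|ac]; case: (eqVneq b c) => [->|bc] //= ab.
- have -> : (if (c < b)%N then b else c) == c = (b < c)%N.
    case: ltngtP => h; rewrite ?(negPf bc) ?eqxx //.
    by move: bc; rewrite -(inj_eq val_inj) /= h eqxx.
  by case: (b < c)%N; case: g og; case: x => [[] i] //= _; ring.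
- have -> : (if (a < c)%N then c else a) == c = (a < c)%N.
    by case: ltngtP => h; rewrite ?(negPf ac) ?eqxx.
  by case: (a < c)%N; case: g' og'; case: x => [[] i] //= _; ring.
- have -> : (if (a < b)%N then b else a) == c = false.
    by case: ifP; rewrite (negPf ac, negPf bc).
  by case: (a < c)%N; case: (b < c)%N; case: x => [[] i] /=; ring.
Qed.

Lemma loc_odd_sqr g a f x : odd_gen g -> loc a [:: (g, a); (g, a)] f x = 0.
Proof.
by case: g => // _; rewrite /loc /= /lscal /ldest /= !eqxx /= ?mulr0 ?mul0r ?mulr0 ?mul0r.
Qed.

Lemma loc_om_pow a m f x :
  loc a (nseq m (Om, a)) f x = (if x.1 then q^-1 ^+ m else 1) * f (x.1, x.2 + m%:R).
Proof.
elim: m x => [|m IH] [s i]; first by rewrite loc_nil addr0 expr0 if_same mul1r.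
rewrite /= loc_cons /lscal /ldest eqxx /= IH /=.
rewrite -addrA -mulrS exprS.
by case: s; ring.
Qed.

Lemma loc_omI_pow a m f x :
  loc a (nseq m (OmInv, a)) f x = (if x.1 then q ^+ m else 1) * f (x.1, x.2 - m%:R).
Proof.
elim: m x => [|m IH] [s i]; first by rewrite loc_nil subr0 expr0 if_same mul1r.
rewrite /= loc_cons /lscal /ldest eqxx /= IH /=.
rewrite -addrA -opprD -mulrS exprS.
by case: s; ring.
Qed.

Lemma loc_even_pow a b g m f x : ~~ odd_gen g -> a != b -> loc b (nseq m (g, a)) f x = f x.
Proof.
move=> og ab; elim: m x => [|m IH] x; first exact: loc_nil.
rewrite /= loc_cons /lscal /ldest /= (negPf ab) (negPf og) /=.
by rewrite mul1r IH.
Qed.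

Lemma Zp2k_eq m m' : ((m%:R : 'Z_(2 * k)) == m'%:R) = (m == m' %[mod 2 * k]).
Proof.
have k1 : (1 < 2 * k)%N by lia.
by rewrite -(inj_eq val_inj) -!val_Zp_nat.
Qed.

(** Shifts by k and by -k agree modulo 2k, so one operator [psiS] can satisfy the relations with
    omega^k and with omega^(-k) simultaneously. *)
Lemma Zp_k_opp : (k%:R : 'Z_(2 * k)) = - k%:R.
Proof.
apply/eqP; rewrite -subr_eq0 opprK -natrD.
by rewrite (Zp2k_eq _ 0) addnn -mul2n modnn mod0n.
Qed.

Lemma tens_single (a : 'I_n) w (f : 'I_n -> L -> F) (x : 'I_n -> L) :
  (forall c, c != a -> loc c w (f c) (x c) = f c (x c)) ->
  tens f x w = loc a w (f a) (x a) * \prod_(c | c != a) f c (x c).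
Proof.
by move=> h; rewrite /tens (bigD1 a) //=; congr (_ * _); apply: eq_bigr.
Qed.

Lemma tens_rel r (f : 'I_n -> L -> F) (x : 'I_n -> L) :
  is_rel q k r -> lin (tens f x) r = 0.
Proof.
case=> a [b]; case=> [->|[->|[->|[->|[->|[->|[->|[->|[->|[ab ->]]]]]]]]]];
  rewrite !lin_cons lin_nil /= /ww /gw /= ?addr0.
- rewrite (@tens_scale (fun=> 1) _ [:: (Om, b); (Om, a)]) ?big1 //; first by ring.
  by move=> c; rewrite mul1r loc_om_om.
- rewrite (@tens_scale (fun=> 1) _ [::]) ?big1 //; first by rewrite /one_w; ring.
  by move=> c; rewrite mul1r loc_om_omI loc_nil.
- rewrite (@tens_scale (fun=> 1) _ [::]) ?big1 //; first by rewrite /one_w; ring.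
  by move=> c; rewrite mul1r loc_omI_om loc_nil.
- by rewrite (tens_scale (fun c => loc_om_psi a b c (f c) (x c))) prod_delta; ring.
- by rewrite (tens_scale (fun c => loc_om_psiS a b c (f c) (x c))) prod_delta; ring.
- case: (eqVneq a b) => [<-|ab].
    by rewrite /tens (bigD1 a) //= loc_odd_sqr // mul0r mulr0 addr0.
  by rewrite (tens_scale (fun c => loc_odd_odd c (f c) (x c) _ _ ab)) // prod_delta; ring.
- case: (eqVneq a b) => [<-|ab].
    by rewrite /tens (bigD1 a) //= loc_odd_sqr // mul0r mulr0 addr0.
  by rewrite (tens_scale (fun c => loc_odd_odd c (f c) (x c) _ _ ab)) // prod_delta; ring.
(* On the other factors the signs of [psi] and [psiS] cancel. On factor [a], [psi psiS] lives on bit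
   0 and [psiS psi] on bit 1, each shifting by k. *)
- rewrite !(tens_single (a := a)) => [|c ca|c ca|c ca]; last first.
  + by rewrite /loc /= /lscal /ldest /= eq_sym (negPf ca) /=; case: ifP => _; ring.
  + by rewrite /loc /= /lscal /ldest /= eq_sym (negPf ca) /=; case: ifP => _; ring.
  + by rewrite loc_even_pow // eq_sym.
  rewrite loc_omI_pow -Zp_k_opp /loc /= /lscal /ldest /= !eqxx /=.
  by case: (x a) => [[] i] /=; ring.
- rewrite !(tens_single (a := a)) => [|c ca|c ca|c ca]; last first.
  + by rewrite /loc /= /lscal /ldest /= eq_sym (negPf ca) /=; case: ifP => _; ring.
  + by rewrite /loc /= /lscal /ldest /= eq_sym (negPf ca) /=; case: ifP => _; ring.
  + by rewrite loc_even_pow // eq_sym.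
  rewrite loc_om_pow /loc /= /lscal /ldest /= !eqxx /= exprVn.
  by case: (x a) => [[] i] /=; ring.
- by rewrite (tens_scale (fun c => loc_odd_odd c (f c) (x c) _ _ ab)) // prod_delta; ring.
Qed.

Lemma tens_ideal i (f : 'I_n -> L -> F) (x : 'I_n -> L) :
  in_ideal q k i -> lin (tens f x) i = 0.
Proof.
move=> ii; elim: ii => [|c u r w p rr _ IH]; first exact: lin_nil.
rewrite lin_cat IH addr0 lin_sandwich.
(* The context is absorbed: [w] acts on the functions, while [u] moves the point and contributes a
   scalar. *)
pose f' b := loc b w (f b); pose x' b := wdest b u (x b).
rewrite (_ : lin _ r = (\prod_b wscal b u (x b)) * lin (tens f' x') r).
  by rewrite tens_rel // !mulr0.
rewrite /lin mulr_sumr; apply: eq_bigr => cm _.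
rewrite mulrCA; congr (_ * _); rewrite /tens -big_split; apply: eq_bigr => b _ /=.
by rewrite !loc_cat {1}/loc loc_cat.
Qed.

(** * Action of the ordered monomials on each tensor factor *)

Definition twist (e : F) f x : F := (if x.1 then e else 1) * f x.

Definition odd_idx (tau : bool * bool * 'I_(4 * k)) := tau.1.1 (+) tau.1.2.

Lemma eq_loc b w f f' x : f =1 f' -> loc b w f x = loc b w f' x.
Proof. by move=> e; rewrite /loc e. Qed.

Lemma loc_mono_neq (a b : 'I_n) tau f x : a != b ->
  loc b (mono a tau) f x = twist (if (a < b)%N && odd_idx tau then -1 else 1) f x.
Proof.
case: tau => [[p d] v] ab; rewrite /mono /odd_idx /twist /=.
have ev y : loc b (nseq v (Om, a)) f y = f y by exact: loc_even_pow.
case: p d => [] []; rewrite /= ?loc_cons ev /lscal /ldest /=;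
  by rewrite ?(negPf ab) /= ?andbT ?andbF; case: (a < b)%N; case: x => [[] i] /=; ring.
Qed.

Definition sgn (t : bidx n k) (s : seq 'I_n) (b : 'I_n) : F :=
  \prod_(a <- s) (if (a < b)%N && odd_idx (t a) then -1 else 1).

Lemma sgn_sqr t s b : sgn t s b * sgn t s b = 1.
Proof.
by rewrite /sgn -big_split big1 //= => a _; case: ifP => _; ring.
Qed.

Lemma eq_sgn (t t' : bidx n k) s b :
  (forall a, (t a).1 = (t' a).1) -> sgn t s b = sgn t' s b.
Proof. by move=> e; apply: eq_bigr => a _; rewrite /odd_idx e. Qed.

Lemma loc_flatten_mono t s b f x : b \notin s ->
  loc b (flatten [seq mono a (t a) | a <- s]) f x = twist (sgn t s b) f x.
Proof.
elim: s x => [|a s IH] x; first by rewrite loc_nil /twist /sgn big_nil if_same mul1r.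
rewrite inE negb_or eq_sym => /andP[ab bs] /=.
rewrite loc_cat loc_mono_neq // /twist IH // /twist /sgn big_cons.
by case: x.1; ring.
Qed.

Definition pre b := take (index b (enum 'I_n)) (enum 'I_n).
Definition post b := drop (index b (enum 'I_n)).+1 (enum 'I_n).

(** On factor [b] every block of another index acts only by a sign on bit 1, so the monomial acts as
    its own block between two such signs. *)
Lemma loc_bmono t b f x :
  loc b (bmono t) f x =
  twist (sgn t (pre b) b) (loc b (mono b (t b)) (twist (sgn t (post b) b) f)) x.
Proof.
have E : enum 'I_n = pre b ++ b :: post b.
  by rewrite /post -drop_index ?mem_enum // cat_take_drop.
have := enum_uniq 'I_n; rewrite E cat_uniq /= => /and3P[_ /norP[bpre _] /andP[bpost _]].
rewrite /bmono E map_cat flatten_cat /= -/(mono b (t b)) loc_cat.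
rewrite loc_flatten_mono // {1}/twist loc_cat; congr (_ * _); apply: eq_loc => y.
exact: loc_flatten_mono.
Qed.

Lemma loc_mono b tau f x : adm tau -> loc b (mono b tau) f x =
  if tau.1.1 then (~~ x.1)%:R * q^-1 ^+ tau.2 * f (true, x.2 + tau.2%:R)
  else if tau.1.2 then x.1%:R * f (false, x.2 + k%:R + tau.2%:R)
  else (if x.1 then q^-1 ^+ tau.2 else 1) * f (x.1, x.2 + tau.2%:R).
Proof.
case: tau => [[[] []] v]; rewrite /adm /mono //= => _;
  by rewrite ?loc_cons loc_om_pow /lscal /ldest /= ?eqxx /= ?mulrA ?mul1r ?mulr1.
Qed.

(** * Functionals that separate the basis monomials *)

(* The exponent with the same class modulo [2k]. *)
Definition conj_exp (v : nat) := if (v < 2 * k)%N then (v + 2 * k)%N else (v - 2 * k)%N.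

(** The point reached from [(j, 0)] along the monomial of [tau], when it acts there by a nonzero
    scalar. *)
Definition target (tau : bool * bool * 'I_(4 * k)) (j : bool) : L :=
  (if tau.1.1 then true else if tau.1.2 then false else j,
   (if tau.1.2 then k%:R else 0) + tau.2%:R).

(** For a monomial with [psi] or [psiS], only the starting bit on which it survives is kept. For a
    pure power omega^v the two bits are combined so that the functional kills the other power with
    the same target: omega^m acts by 1 on bit 0 and by q^(-m) on bit 1. *)
Definition weight (tau : bool * bool * 'I_(4 * k)) (j : bool) : F :=
  if tau.1.1 then (~~ j)%:R else if tau.1.2 then j%:R
  else if j then 1 else - q^-1 ^+ conj_exp tau.2.

Definition ind y0 y : F := (y == y0)%:R.

(** Either the starting bit or the final bit does not match. The arbitrary factor [f] accommodates
    the signs coming from the other blocks. *)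
Lemma weight_pattern_neq b tau tau' f j : adm tau -> adm tau' -> tau.1 != tau'.1 ->
  weight tau j * loc b (mono b tau') (fun y => f y * ind (target tau j) y) (j, 0) = 0.
Proof.
move=> ad ad'; rewrite loc_mono // /weight /target /ind.
case: tau tau' ad ad' => [[[] []] v] [[[] []] v'] //=; case: j => //= _ _ _;
  by rewrite ?xpair_eqE /= ?mulr0 ?mul0r ?mulr0.
Qed.

Lemma Zp2k_eq_small (v v' : nat) : (v < 2 * k)%N -> (v' < 2 * k)%N ->
  ((v%:R : 'Z_(2 * k)) == v'%:R) = (v == v').
Proof. by move=> hv hv'; rewrite Zp2k_eq !modn_small. Qed.

Lemma Zp2k_eq_conj (v v' : nat) : (v < 4 * k)%N -> (v' < 4 * k)%N -> v' != v ->
  (v'%:R : 'Z_(2 * k)) == v%:R -> v' = conj_exp v.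
Proof.
move=> hv hv' nv; rewrite Zp2k_eq /conj_exp => /eqP e.
have k2 : (0 < 2 * k)%N by lia.
have : (v %/ (2 * k) < 2)%N by rewrite ltn_divLR // mulnA.
have : (v' %/ (2 * k) < 2)%N by rewrite ltn_divLR // mulnA.
have := divn_eq v (2 * k); have := divn_eq v' (2 * k); rewrite e.
have := @ltn_pmod v (2 * k) k2.
move: (v %/ _)%N (v' %/ _)%N (v %% _)%N {e} => [|[|d]] [|[|d']] r //; case: ifP; lia.
Qed.

(** If [psi] or [psiS] occurs, the exponents are below 2k, hence distinct modulo 2k, and the targets
    differ. For pure powers of omega, only the conjugate exponent shares the target, and the weights
    cancel its two contributions. *)
Lemma weight_exp_neq b tau tau' : adm tau -> adm tau' -> tau.1 = tau'.1 ->
  tau.2 != tau'.2 ->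
  \sum_(j : bool) weight tau j * loc b (mono b tau') (ind (target tau j)) (j, 0) = 0.
Proof.
move=> ad ad' e nv; rewrite big_bool /= !loc_mono //.
rewrite /weight /target /ind -!e /= ?xpair_eqE /= !add0r.
case: tau tau' ad ad' e nv => [[p d] v] [[p' d'] v'] /= ad ad' [ep ed] nv.
have nv' : (v' : nat) != v by rewrite eq_sym.
rewrite -{p'}ep -{d'}ed in ad'; move: ad ad'; rewrite /adm.
case: p d => [] [] //=; rewrite ?mul0r ?mulr0 ?add0r ?addr0 => hv hv'.
- by rewrite Zp2k_eq_small ?(negPf nv') ?mulr0 //; lia.
- rewrite (inj_eq (addrI _)) Zp2k_eq_small ?(negPf nv') ?mulr0 //; lia.
case: (boolP (_ == _)) => [h|_]; last by rewrite !mulr0 addr0.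
by rewrite -(Zp2k_eq_conj _ _ nv' h) //; ring.
Qed.

Lemma weight_eq b tau : adm tau ->
  \sum_(j : bool) weight tau j * loc b (mono b tau) (ind (target tau j)) (j, 0) != 0.
Proof.
move=> ad; rewrite big_bool /= !loc_mono // /weight /target /ind /= ?xpair_eqE /= !add0r.
have qm m : q^-1 ^+ m != 0 by rewrite expf_neq0 // invr_eq0.
case: tau ad => [[[] []] v]; rewrite /adm //= => _;
  rewrite ?add0r !eqxx ?mul0r ?mul1r ?mulr0 ?mulr1 ?add0r ?addr0 ?oner_neq0 ?qm //.
(* For pure powers the value is q^(-v) minus the same power at the conjugate exponent; the two
   differ by a factor q^(2k) or q^(-2k). *)
have h2 : q^-1 ^+ (2 * k) != 1 by rewrite exprVn invr_eq1.
rewrite subr_eq0 /conj_exp; case: ifP => hv.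
  by rewrite exprD -{1}[_ ^+ v]mulr1 (inj_eq (mulfI (qm _))) eq_sym.
have {1}-> : (v : nat) = (v - 2 * k + 2 * k)%N by lia.
by rewrite exprD -{2}[_ ^+ (v - _)]mulr1 (inj_eq (mulfI (qm _))).
Qed.

(** A functional of the monomial [t'], nonzero at [t] and zero at all other admissible indices. The
    inserted signs are those of [t], so that they cancel against the signs of any [t'] with the same
    pattern of [psi] and [psiS]. *)
Definition dual (t t' : bidx n k) : F :=
  \prod_b \sum_(j : bool) weight (t b) j * (if j then sgn t (pre b) b else 1) *
    loc b (bmono t') (twist (sgn t (post b) b) (ind (target (t b) j))) (j, 0).

(** Expanding the product shows that [dual t] is a combination of the functionals [tens], which
    vanish on the ideal. *)
Lemma dual_sum (t t' : bidx n k) : dual t t' = \sum_(j : {ffun 'I_n -> bool})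
  (\prod_b (weight (t b) (j b) * (if j b then sgn t (pre b) b else 1))) *
  tens (fun b => twist (sgn t (post b) b) (ind (target (t b) (j b))))
       (fun b => (j b, 0)) (bmono t').
Proof.
by rewrite /dual bigA_distr_bigA; apply: eq_bigr => j _; rewrite /tens -big_split.
Qed.

Lemma dual_same_pattern (t t' : bidx n k) : (forall a, (t a).1 = (t' a).1) ->
  dual t t' = \prod_b \sum_(j : bool)
    weight (t b) j * loc b (mono b (t' b)) (ind (target (t b) j)) (j, 0).
Proof.
move=> e; apply: eq_bigr => b _; apply: eq_bigr => j _.
rewrite loc_bmono -!(eq_sgn _ _ e) {1}/twist /=.
rewrite -mulrA; congr (_ * _); rewrite mulrA.
have -> : (if j then sgn t (pre b) b else 1) * (if j then sgn t (pre b) b else 1) = 1.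
  by case: j; rewrite ?sgn_sqr ?mulr1.
rewrite mul1r.
apply: eq_loc => y; rewrite /twist mulrA.
by case: y.1; rewrite ?sgn_sqr ?mulr1 ?mul1r.
Qed.

Lemma dual_neq (t t' : bidx n k) :
  admissible t -> admissible t' -> t' != t -> dual t t' = 0.
Proof.
move=> /forallP ad /forallP ad' ntt'.
case: (boolP [forall a, (t a).1 == (t' a).1]) => [/forallP e|].
  have {}e a : (t a).1 = (t' a).1 by apply/eqP.
  have [b nb] : exists b, (t b).2 != (t' b).2.
    apply/existsP; apply: contraNT ntt' => /existsPn h; apply/eqP/ffunP => b.
    by have := e b; have := h b; rewrite negbK;
      case: (t b) (t' b) => [x v] [x' v'] /= /eqP-> ->.
  rewrite dual_same_pattern // (bigD1 b) //= weight_exp_neq ?mul0r //.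
  - exact: ad.
  - exact: ad'.
(* When the patterns differ at [b], each summand of the factor at [b] vanishes separately, so the
   uncancelled signs are harmless. *)
case/forallPn => b nb; rewrite /dual (bigD1 b) //= big1 ?mul0r // => j _.
rewrite loc_bmono {1}/twist /= mulrCA mulrAC.
set g := twist _ _; pose h y := (if y.1 then sgn t' (post b) b else 1) *
  (if y.1 then sgn t (post b) b else 1).
rewrite (_ : loc _ _ _ _ =
  loc b (mono b (t' b)) (fun y => h y * ind (target (t b) j) y) (j, 0)).
  by rewrite weight_pattern_neq ?mul0r ?mulr0 //; [apply: ad | apply: ad'].
by apply: eq_loc => y; rewrite /g /twist mulrA.
Qed.

Lemma dual_eq t : admissible t -> dual t t != 0.
Proof.
move=> /forallP ad; rewrite dual_same_pattern // prodf_seq_neq0.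
by apply/allP => b _ /=; apply: weight_eq; apply: ad.
Qed.

Lemma independence (c : bidx n k -> F) :
  cl_eq q k (bcomb c) [::] -> forall t, admissible t -> c t = 0.
Proof.
move=> [i [ii ei]] t adt.
have ev (f : 'I_n -> L -> F) (x : 'I_n -> L) :
    \sum_(t' | admissible t') c t' * tens f x (bmono t') = 0.
  by rewrite -lin_bcomb -(tens_ideal f x ii) -(lin_coefB _ ei) lin_nil subr0.
have : \sum_(t' | admissible t') c t' * dual t t' = 0.
  under eq_bigr => t' _ do rewrite dual_sum mulr_sumr.
  rewrite exchange_big big1 //= => j _.
  under eq_bigr => t' _ do rewrite mulrCA.
  by rewrite -mulr_sumr ev mulr0.
rewrite (bigD1 t) //= big1 ?addr0 => [/eqP|t' /andP[adt' nt]]; last first.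
  by rewrite dual_neq ?mulr0.
by rewrite mulf_eq0 (negPf (dual_eq adt)) orbF => /eqP.
Qed.

End Independence.

Theorem theorem3p6 (F : fieldType) (q : F) (n k : nat)
  (char2 : (2%:R : F) != 0) (q_neq0 : q != 0)
  (n_gt0 : (0 < n)%N) (k_gt0 : (0 < k)%N)
  (hq : q ^+ (2 * k) != 1) :
  is_basis_B' n q k.
Proof.
split; first exact: spanning.
exact: independence.
Qed.
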